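(* Let $G=(N,v)$ be an arbitrary $\mathrm{ISN}_\Delta$ game among industrial agents in $N$ under a policy $\wp:2^N\to\{p^+,p^\circ,p^-\}$. If the promoted groups are mutually exclusive, i.e. $S\cap S'=\emptyset$ for all distinct $S,S'\in P_\wp^+$, then there exists a set of regulatory incentive rules $\Re$ over $N$ such that, in the coordinated ISN $C=G+\Re$, the symbiotic network among every promoted group $S\in P_\wp^+$ is implementable, and moreover any ISN among a prohibited agent group in $P_\wp^-$ is unimplementable.
   Context: A cooperative game (with transferable utility) is a pair $(N,v)$ where $N$ is a finite set of agents and $v:2^N\to\mathbb{R}$. It is superadditive if $v(S\cup T)\ge v(S)+v(T)$ for all disjoint $S,T\subseteq N$. ISN game: let $N$ be a non-empty finite set of industrial agents and, for every $S\subseteq N$, let $T(S)$ and $O(S)$ be real numbers (total traditional cost and total operational cost of $S$). The Industrial Symbiotic Network (ISN) among agents in $N$ is a normalized superadditive cooperative game $(N,v)$ with $v(S)=0$ if $|S|\le 1$ and $v(S)=T(S)-O(S)$ otherwise. An $\mathrm{ISN}_\Delta$ game is an ISN game with $|N|\ge 3$. Policy: a normative socio-economic policy is a function $\wp:2^N\to\{p^+,p^\circ,p^-\}$ labelling groups as promoted, permitted or prohibited; $P_\wp^+=\{S\subseteq N:\wp(S)=p^+\}$ and $P_\wp^-=\{S\subseteq N:\wp(S)=p^-\}$. Promoted groups are non-empty. An ISN (symbiotic network) among a prohibited group refers to a group of at least two agents. Incentive rules: a set of regulatory incentive rules is a basic Marginal Contribution Net (MC-Net), i.e. a finite set of rules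 $\Re=\{\rho_i:(\mathcal{P}_i,\mathcal{N}_i)\mapsto \iota_i\}_{i\in K}$ with $\mathcal{P}_i\subseteq N$, $\mathcal{N}_i\subset N$, $\mathcal{P}_i\cap\mathcal{N}_i=\emptyset$ and $\iota_i\in\mathbb{R}\setminus\{0\}$. Rule $\rho_i$ is applicable to $S\subseteq N$ if $\mathcal{P}_i\subseteq S$ and $\mathcal{N}_i\cap S=\emptyset$. The incentive value $\iota(S)$ is the sum of $\iota_i$ over the rules applicable to $S$. The coordinated ISN $C=G+\Re$ is the cooperative game $(N,c)$ with $c(S)=v(S)+\iota(S)$ for all $S\subseteq N$. Implementability: for a game $(M,c)$ with $m=|M|$, the fair allocation is the Shapley allocation $(\Phi_i(c))_{i\in M}$, $\Phi_i(c)=\sum_{S\subseteq M\setminus\{i\}}\frac{|S|!(m-|S|-1)!}{m!}\big(c(S\cup\{i\})-c(S)\big)$, and an allocation $x\in\mathbb{R}^M$ is stable (a core allocation) if $\sum_{i\in S}x_i\ge c(S)$ for all $S\subseteq M$ and $\sum_{i\in M}x_i=c(M)$. The game is implementable (short for: implementable in a fair and stable manner) if it has an allocation that is both fair and stable, and unimplementable otherwise. The ISN among a group $S\subseteq N$ is implementable (unimplementable) in $C=(N,c)$ if the sub-game $(S,c|_{2^S})$ is implementable (unimplementable). *)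

(* Defs.v *)
From HB Require Import structures.
From mathcomp Require Import all_boot all_order all_algebra.
From mathcomp Require Import finmap reals.

Set Implicit Arguments.
Unset Strict Implicit.
Unset Printing Implicit Defensive.

Import Order.TTheory GRing.Theory Num.Theory.

Local Open Scope ring_scope.

(** The agent set N is a finite type [A], and a group of agents is a term of
    [{set A}]. A game (M, c) on a group M is given by M and a function [c] on
    all of [{set A}] of which only the values on subsets of M are used; so
    the sub-game (S, c|_{2^S}) of a game [c] is the pair [S], [c]. Likewise an
    allocation in R^M is a function on [A] read only on M. *)

Definition game (A : finType) (R : realType) : Type := {set A} -> R.

Definition superadditive (A : finType) (R : realType) (v : game A R) : Prop :=
  forall S T : {set A}, S :&: T = set0 -> v S + v T <= v (S :|: T).

(** [T] and [O] are the total traditional and operational costs of groups. *)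
Definition isn_value (A : finType) (R : realType) (T O : {set A} -> R) :
  game A R :=
  fun S => if (#|S| <= 1)%N then 0 else T S - O S.

Definition isn_game (A : finType) (R : realType) (T O : {set A} -> R)
  (v : game A R) : Prop :=
  (forall S : {set A}, v S = isn_value T O S) /\ superadditive v.

Variant label := Promoted | Permitted | Prohibited.

Definition policy (A : finType) : Type := {set A} -> label.

Definition promoted (A : finType) (wp : policy A) : {set {set A}} :=
  [set S | if wp S is Promoted then true else false].

Definition prohibited (A : finType) (wp : policy A) : {set {set A}} :=
  [set S | if wp S is Prohibited then true else false].

(** The triple (P, N, iota) stands for the basic MC-net rule
    (P, N) |-> iota. *)
Definition mc_rule_wf (A : finType) (R : realType)
  (r : {set A} * {set A} * R) : bool :=
  [&& r.1.2 \proper [set: A], r.1.1 :&: r.1.2 == set0 & r.2 != 0].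

Record mc_rule (A : finType) (R : realType) := McRule {
  mc_rule_val :> {set A} * {set A} * R;
  mc_rule_valP : mc_rule_wf mc_rule_val }.

HB.instance Definition _ (A : finType) (R : realType) :=
  [isSub for @mc_rule_val A R].
HB.instance Definition _ (A : finType) (R : realType) :=
  [Choice of mc_rule A R by <:].

Definition rule_pos (A : finType) (R : realType) (r : mc_rule A R) :
  {set A} := (mc_rule_val r).1.1.
Definition rule_neg (A : finType) (R : realType) (r : mc_rule A R) :
  {set A} := (mc_rule_val r).1.2.
Definition rule_value (A : finType) (R : realType) (r : mc_rule A R) :
  R := (mc_rule_val r).2.

Definition applicable (A : finType) (R : realType) (r : mc_rule A R)
  (S : {set A}) : bool :=
  (rule_pos r \subset S) && (rule_neg r :&: S == set0).

Definition incentive (A : finType) (R : realType) (Re : {fset mc_rule A R})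
  (S : {set A}) : R :=
  \sum_(r <- enum_fset Re | applicable r S) rule_value r.

Definition coordinated (A : finType) (R : realType) (v : game A R)
  (Re : {fset mc_rule A R}) : game A R :=
  fun S => v S + incentive Re S.

Definition shapley (A : finType) (R : realType) (M : {set A}) (c : game A R)
  (i : A) : R :=
  \sum_(S : {set A} | S \subset M :\ i)
    ((#|S|)`! * (#|M| - #|S| - 1)`!)%:R / ((#|M|)`!)%:R * (c (i |: S) - c S).

Definition fair (A : finType) (R : realType) (M : {set A}) (c : game A R)
  (x : A -> R) : Prop :=
  forall i : A, i \in M -> x i = shapley M c i.

Definition stable (A : finType) (R : realType) (M : {set A}) (c : game A R)
  (x : A -> R) : Prop :=
  (forall S : {set A}, S \subset M -> c S <= \sum_(i in S) x i) /\
  \sum_(i in M) x i = c M.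

Definition implementable (A : finType) (R : realType) (M : {set A})
  (c : game A R) : Prop :=
  exists x : A -> R, fair M c x /\ stable M c x.

(* Main.v *)
(** Rules of the form [(S, ~: S) |-> w] apply to the group [S] only, so the
    coordinated game can be made any game vanishing on the empty group. Take the
    game worth 0 on promoted groups and on groups of at most one agent, and -1
    elsewhere. A prohibited group of two or more agents is worth less than its
    members taken separately, so its core is empty. A promoted group [P] has no
    other promoted subgroup, so the game is symmetric on [P]; the Shapley
    allocation splits [c P = 0] equally, and the zero allocation is stable. *)
Require Import Defs.
From mathcomp Require Import all_boot all_order all_algebra.
From mathcomp Require Import finmap reals.

Local Open Scope ring_scope.

Import Order.TTheory GRing.Theory Num.Theory.

Lemma incentive_complete (R : realType) (A : finType) (w : game A R) :
  w set0 = 0 -> exists Re : {fset mc_rule A R}, incentive Re =1 w.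
Proof.
move=> w0.
pose rule (S : {set A}) : {set A} * {set A} * R := (S, ~: S, w S).
(* For empty [S] the complement is all of [A], hence not proper; [w0] makes both sides false
   there. *)
have rule_wf S : mc_rule_wf (rule S) = (w S != 0).
  rewrite /mc_rule_wf /= setICr eqxx /=; case: eqP => [|/eqP wS]; first by rewrite andbF.
  rewrite andbT properT; apply: contra_neq wS => SC.
  by rewrite -(setCK S) SC setCT.
(* Groups with [w S = 0] give ill-formed rules, which [insub] discards. *)
pose rules : seq (mc_rule A R) := pmap insub [seq rule B | B : {set A}].
have rules_uniq : uniq rules.
  by apply: pmap_sub_uniq; rewrite map_inj_uniq ?enum_uniq // => S1 S2 [].
exists [fset r in rules]%fset => S; rewrite /incentive.
rewrite (perm_big rules) /=; last first.
  by apply: uniq_perm (fset_uniq _) rules_uniq _ => r; rewrite !inE.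
pose app (t : {set A} * {set A} * R) := (t.1.1 \subset S) && (t.1.2 :&: S == set0).
rewrite -(big_map (@mc_rule_val A R) app (fun t => t.2)).
rewrite (pmap_filter (@insubK _ _ (mc_rule A R))) big_filter_cond big_map big_enum_cond /=.
rewrite (eq_bigl (fun S' => (S' == S) && (w S != 0))) => [|S']; last first.
  (* The two applicability tests amount to [S' \subset S] and [S \subset S']. *)
  rewrite isSome_insub rule_wf /app /= setIC -setDE setD_eq0 andbC -eqEsubset.
  by case: eqP => // ->.
by case: eqP => [->|_]; [rewrite big1 // => ?; rewrite andbF|
  rewrite (eq_bigl (pred1 S)) ?big_pred1_eq // => ?; rewrite andbT].
Qed.

Lemma sum_subsets_card (R : nmodType) (A : finType) (M : {set A}) (F : nat -> R) :
  \sum_(S : {set A} | S \subset M) F #|S| =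
  \sum_(k < #|M|.+1) F k *+ 'C(#|M|, k).
Proof.
(* [inord] is faithful here: a subset of [M] has at most [#|M|] elements. *)
rewrite (partition_big (fun S : {set A} => inord #|S| : 'I_(#|M|.+1)) xpredT) //=.
apply: eq_bigr => k _.
have cardE (S : {set A}) : (S \subset M) && (inord #|S| == k :> 'I_(#|M|.+1)) =
    (S \in [set B : {set A} | B \subset M & #|B| == k]).
  rewrite inE; case: (boolP (S \subset M)) => //= SM.
  by rewrite -val_eqE /= inordK // ltnS subset_leq_card.
rewrite (eq_bigl _ _ cardE) -cards_draws -sumr_const.
by apply: eq_bigr => S; rewrite inE => /andP[_ /eqP ->].
Qed.

(** With [m = #|M|], the ['C(m - 1, k)] coalitions of size [k] avoiding [i] have total weight
    [1 / m], whatever [k], so the increments of [f] telescope. *)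
Lemma shapley_symmetric (R : realType) (A : finType) (M : {set A}) (c : game A R)
    (f : nat -> R) (i : A) :
  (forall S : {set A}, S \subset M -> c S = f #|S|) -> i \in M ->
  shapley M c i = (f #|M| - f 0%N) / #|M|%:R.
Proof.
move=> cf iM.
pose F k : R := (k`! * (#|M| - k - 1)`!)%:R / ((#|M|)`!)%:R * (f k.+1 - f k).
rewrite /shapley (eq_bigr (fun S : {set A} => F #|S|)) => [|S SM]; last first.
  have iS : i \notin S by apply: contraTN SM => iS; apply/subsetPn; exists i; rewrite ?setD11.
  have SM' : S \subset M := subset_trans SM (subsetDl M [set i]).
  by rewrite !cf ?subUset ?sub1set ?iM ?SM' // cardsU1 iS.
have cM : #|M| = #|M :\ i|.+1 by rewrite (cardsD1 i) iM.
rewrite sum_subsets_card -cM -telescope_sumr // big_mkord mulr_suml.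
apply: eq_bigr => -[k /= kM] _; move: kM; rewrite /F cM ltnS => kM.
rewrite -mulrnAl mulrC; congr (_ * _).
rewrite -subnDA addn1 subSS -mulrnAl -mulrnA mulnC bin_fact // factS natrM invfM.
by rewrite mulrCA divff ?mulr1 // pnatr_eq0 -lt0n fact_gt0.
Qed.

Theorem theorem3 (R : realType) (A : finType) (T O : {set A} -> R)
    (v : game A R) (wp : policy A)
    (hA : (3 <= #|A|)%N)
    (hv : isn_game T O v)
    (hne : set0 \notin promoted wp)
    (hdisj : forall S S' : {set A}, S \in promoted wp -> S' \in promoted wp ->
       S != S' -> S :&: S' = set0) :
  exists Re : {fset mc_rule A R},
    (forall S : {set A}, S \in promoted wp ->
       implementable S (coordinated v Re)) /\
    (forall S : {set A}, S \in prohibited wp -> (2 <= #|S|)%N ->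
       ~ implementable S (coordinated v Re)).
Proof.
pose c : game A R := fun S => if (S \in promoted wp) || (#|S| <= 1)%N then 0 else -1.
have c_le0 S : c S <= 0 by rewrite /c; case: ifP; rewrite ?lerN10.
have [|Re Re_c] := @incentive_complete R A (fun S => c S - v S).
  by rewrite /c (proj1 hv) /isn_value cards0 orbT subrr.
have cE : coordinated v Re =1 c by move=> S; rewrite /coordinated Re_c addrC subrK.
exists Re; split=> P.
  move=> Pprom; exists (fun=> 0); split; last first.
    by split=> [S _|]; rewrite big1 ?cE // /c Pprom.
  move=> i iP.
  pose f k : R := if (k == #|P|) || (k <= 1)%N then 0 else -1.
  rewrite (@shapley_symmetric _ _ _ _ f) // => [|S SP].
    by rewrite /f eqxx orbT subrr mul0r.
  rewrite cE /c /f; congr (if _ || _ then _ else _).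
  have -> : (#|S| == #|P|) = (S == P) by rewrite eqEcard SP eqn_leq subset_leq_card.
  (* A promoted [S] inside [P] but distinct from it would be disjoint from [P], hence empty, against
     [hne]. *)
  apply/idP/eqP => [Sprom|-> //]; apply/eqP; apply: contraNT hne => SneP.
  by rewrite -(hdisj _ _ Sprom Pprom SneP) (setIidPl SP).
move=> Pproh P2 [x [_ [core eff]]].
have cP : c P = -1.
  rewrite /c leqNgt P2 orbF; case: ifP => //.
  by move: Pproh; rewrite !inE; case: (wp P).
(* Singletons are worth 0, so their core constraints make each [x i] nonnegative, while efficiency
   demands a total of -1. *)
have: 0 <= \sum_(i in P) x i.
  apply: sumr_ge0 => i iP; have := core [set i].
  by rewrite cE /c cards1 orbT big_set1 sub1set; apply.
by rewrite eff cE cP oppr_ge0 ler10.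
Qed.
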